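(* For $p=3$ and all $L\ge 0$, \[a_{\mathrm{dbl}}(L)=F(2L+2)=U_L(3/2),\] where $F$ is the Fibonacci sequence ($F(1)=F(2)=1$) and $U_L$ is the Chebyshev polynomial of the second kind.
   Context: For a digit string $(d_1,\dots,d_L)\in\{0,1,2\}^L$ (the base-$3$ digits of $m\in[0,3^L)$, least significant first), set $\sigma_0=0$, $\sigma_j=\lfloor(2d_j+\sigma_{j-1})/3\rfloor$. The string (the doubling of $m$) is cascade-free if there is no $j$ with $2d_j=2$ (i.e. $d_j=1$) and $\sigma_{j-1}=1$. $a_{\mathrm{dbl}}(L)$ is the number of cascade-free strings of length $L$. Chebyshev polynomials of the second kind: $U_0=1$, $U_1(x)=2x$, $U_n(x)=2xU_{n-1}(x)-U_{n-2}(x)$. *)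

(* Defs.v *)
From mathcomp Require Import all_boot all_order all_algebra.
Set Implicit Arguments.
Unset Strict Implicit.
Unset Printing Implicit Defensive.
Import GRing.Theory.

(* Digit strings are 0-indexed: the j-th digit d_j (1 <= j <= L), least
   significant first, is at position j.-1; carry s j is sigma_j, which uses
   only d_1, ..., d_j. *)
Fixpoint carry (s : seq 'I_3) (j : nat) : nat :=
  if j is i.+1 then (2 * nth ord0 s i + carry s i) %/ 3 else 0.

Definition cascade_free (L : nat) (d : L.-tuple 'I_3) : bool :=
  ~~ [exists i : 'I_L, (2 * tnth d i == 2) && (carry d i == 1)].

Definition a_dbl (L : nat) : nat := #|[set d : L.-tuple 'I_3 | cascade_free d]|.

Fixpoint fib (n : nat) : nat :=
  if n is m.+1 then if m is k.+1 then fib m + fib k else 1 else 0.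

Local Open Scope ring_scope.

Fixpoint chebyshevU (R : nzRingType) (n : nat) : {poly R} :=
  if n is m.+1 then
    if m is k.+1 then 2%:R *: 'X * chebyshevU R m - chebyshevU R k
    else 2%:R *: 'X
  else 1.

(* Main.v *)
Require Import Defs.
From mathcomp Require Import all_boot all_order all_algebra.
From mathcomp Require Import ring.

(** The carries of a doubling in base 3 are driven by a two-state automaton:
    from carry 0 the digits 0, 1 lead to carry 0 and 2 leads to carry 1; from
    carry 1 the digit 1 is the forbidden cascade, 0 leads to 0 and 2 to 1.
    So the numbers A(L), B(L) of admissible strings read from carry 0 and 1
    satisfy A(L+1) = 2 A(L) + B(L) and B(L+1) = A(L) + B(L), with
    A(0) = B(0) = 1, whence A(L) = F(2L+2) and B(L) = F(2L+1).  The even-indexed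
    Fibonacci numbers obey F(n+4) = 3 F(n+2) - F(n), which is the Chebyshev
    recurrence at 3/2. *)

Import GRing.Theory.

(** The incoming carry is a parameter so that induction can strip the least significant digit,
    whereas [carry] recurses from the top position down. *)
Fixpoint carry_from (c : nat) (s : seq 'I_3) (j : nat) : nat :=
  if j is i.+1 then (2 * nth ord0 s i + carry_from c s i) %/ 3 else c.

Fixpoint cascade_free_from (c : nat) (s : seq 'I_3) : bool :=
  if s is x :: s' then
    ~~ ((2 * x == 2) && (c == 1)) && cascade_free_from ((2 * x + c) %/ 3) s'
  else true.

Lemma carry_from0 s j : carry s j = carry_from 0 s j.
Proof. by elim: j => //= j ->. Qed.

Lemma carry_from_cons c x s j :
  carry_from c (x :: s) j.+1 = carry_from ((2 * x + c) %/ 3) s j.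
Proof. by elim: j => // j IHj; rewrite /= -IHj. Qed.

Lemma cascade_free_fromP c s :
  reflect (forall i, i < size s ->
             ~~ ((2 * nth ord0 s i == 2) && (carry_from c s i == 1)))
          (cascade_free_from c s).
Proof.
elim: s c => [|x s IHs] c; first by apply: ReflectT.
apply: (iffP andP) => [[Hx /IHs Hs] [|i] Hi|H].
- exact: Hx.
- by rewrite carry_from_cons; apply: Hs.
split; first exact: (H 0).
by apply/IHs => i Hi; rewrite -carry_from_cons; apply: (H i.+1).
Qed.

Lemma cascade_freeE L (d : L.-tuple 'I_3) :
  cascade_free d = cascade_free_from 0 d.
Proof.
rewrite /cascade_free negb_exists; apply/forallP/cascade_free_fromP.
  move=> H i; rewrite size_tuple => Hi.
  by have := H (Ordinal Hi); rewrite (tnth_nth ord0) carry_from0.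
move=> H i; rewrite (tnth_nth ord0) carry_from0; apply: H.
by rewrite size_tuple.
Qed.

Lemma sum_tuple_cons (T : finType) L (F : seq T -> nat) :
  \sum_(d : L.+1.-tuple T) F d = \sum_x \sum_(d : L.-tuple T) F (x :: d).
Proof.
rewrite pair_big /=.
rewrite (reindex (fun p : T * L.-tuple T => [tuple of p.1 :: p.2])) //=.
exists (fun d : L.+1.-tuple T => (thead d, [tuple of behead d])).
  by move=> [x d] _; congr pair; apply: val_inj.
by move=> d _; rewrite [RHS]tuple_eta.
Qed.

Lemma fibSS n : fib n.+2 = fib n.+1 + fib n.
Proof. by []. Qed.

Lemma sum_cascade_free_from L :
  \sum_(d : L.-tuple 'I_3) cascade_free_from 0 d = fib (2 * L + 2) /\
  \sum_(d : L.-tuple 'I_3) cascade_free_from 1 d = fib (2 * L + 1).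
Proof.
elim: L => [|L [IH0 IH1]].
  by split; rewrite (big_pred1 [tuple]) // => d; apply/esym/eqP; exact: tuple0.
have -> : 2 * L.+1 + 2 = (2 * L).+4 by rewrite mulnS; ring.
have -> : 2 * L.+1 + 1 = (2 * L).+3 by rewrite mulnS; ring.
rewrite !fibSS (sum_tuple_cons _ _ (cascade_free_from 0)).
rewrite (sum_tuple_cons _ _ (cascade_free_from 1)).
(* [big1] removes the one vanishing sum: digit 1 read from carry 1, the cascade. *)
rewrite !big_ord_recl !big_ord0 /= IH0 IH1 big1 //.
by rewrite addn1 addn2 fibSS; split; ring.
Qed.

(** Kept additive because subtraction in [nat] truncates. *)
Lemma fib_even_rec n : fib n.+4 + fib n = 3 * fib n.+2.
Proof. by rewrite !fibSS; ring. Qed.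

Lemma chebyshevUSS (R : nzRingType) n :
  (chebyshevU R n.+2 = 2%:R *: 'X * chebyshevU R n.+1 - chebyshevU R n)%R.
Proof. by []. Qed.

Lemma chebyshevU_fib L :
  ((chebyshevU rat L).[3%:R / 2%:R] = (fib (2 * L + 2))%:R)%R.
Proof.
elim/ltn_ind: L => -[|[|L]] IH; [by rewrite hornerE | by rewrite !hornerE |].
rewrite chebyshevUSS hornerD hornerN hornerM hornerZ hornerX !IH //.
have -> : 2 * L.+2 + 2 = (2 * L + 2).+4 by rewrite !mulnS; ring.
have -> : 2 * L.+1 + 2 = (2 * L + 2).+2 by rewrite !mulnS; ring.
(* Cancelling the subtracted term makes [fib_even_rec] applicable; what remains is that the
   Chebyshev factor 2x equals 3 at x = 3/2. *)
apply: (addIr (fib (2 * L + 2))%:R%R).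
rewrite -natrD fib_even_rec natrM subrK.
by field.
Qed.

Theorem theorem5p5 (L : nat) :
  a_dbl L = fib (2 * L + 2) /\
  ((fib (2 * L + 2))%:R = (chebyshevU rat L).[3%:R / 2%:R] :> rat)%R.
Proof.
split; last by rewrite chebyshevU_fib.
have [<- _] := sum_cascade_free_from L.
rewrite /a_dbl -sum1dep_card big_mkcond /=.
by apply: eq_bigr => d _; rewrite -cascade_freeE; case: (cascade_free d).
Qed.
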